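(* For any real $C<\infty$ and any integer $n\geq 5$, there exists a Riemannian metric $g$ on the sphere $S^n$ such that the inequality $$\int_{S^n}\left(R-\overline R\right)^2 \;\leq\; C\int_{S^n}\left|\overset{\circ}{\mathrm{Ric}}\right|^2$$ fails.
   Context: Metrics are smooth. For a Riemannian metric $g$ on $S^n$, $\mathrm{Ric}$ is its Ricci tensor, $R$ its scalar curvature (the $g$-trace of $\mathrm{Ric}$), $\overline R=\frac{1}{\mathrm{vol}(S^n,g)}\int_{S^n}R$ the average of $R$, and $\overset{\circ}{\mathrm{Ric}}:=\mathrm{Ric}-\frac{R}{n}g$ the traceless Ricci tensor. Integrals are with respect to the Riemannian volume measure of $g$ and $|\cdot|$ is the tensor norm induced by $g$. *)

(* Defs.v *)
From HB Require Import structures.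
From mathcomp Require Import all_boot all_order all_algebra.
From mathcomp Require Import all_classical all_reals all_analysis.
Set Implicit Arguments.
Unset Strict Implicit.
Unset Printing Implicit Defensive.
Import Order.TTheory GRing.Theory Num.Theory.
Import numFieldNormedType.Exports.
Local Open Scope classical_set_scope.
Local Open Scope ring_scope.

(** * Lebesgue measure on R^n *)

Section cons_measure.
Context d (T : measurableType d) (R : realType) (n : nat).
Variables (m : {sigma_finite_measure set T -> \bar R})
          (mu : {sigma_finite_measure set (n.-tuple T) -> \bar R}).

Definition tuple_cons (p : T * n.-tuple T) : n.+1.-tuple T :=
  [the n.+1.-tuple T of p.1 :: p.2].

Lemma measurable_tuple_cons : measurable_fun [set: T * n.-tuple T] tuple_cons.
Proof. by apply: measurable_cons. Qed.

(* The image of the product measure [m \x mu] under [tuple_cons]. *)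
Definition cons_measure : set (n.+1.-tuple T) -> \bar R :=
  pushforward (m \x mu)%E tuple_cons.

Let cons_measure0 : cons_measure set0 = 0%E.
Proof. by rewrite /cons_measure /pushforward preimage_set0 measure0. Qed.

Let cons_measure_ge0 A : (0 <= cons_measure A)%E.
Proof. by rewrite /cons_measure /pushforward. Qed.

Let cons_measure_sigma_additive : semi_sigma_additive cons_measure.
Proof.
have mf := measurable_tuple_cons.
move=> F mF tF mUF; rewrite /cons_measure /pushforward preimage_bigcup.
apply: measure_semi_sigma_additive.
- by move=> i; rewrite -[X in measurable X]setTI; exact: mf.
- apply/trivIsetP => /= i j _ _ ij; rewrite -preimage_setI.
  by move/trivIsetP : tF => /(_ _ _ _ _ ij) ->//; rewrite preimage_set0.
- by rewrite -preimage_bigcup -[X in measurable X]setTI; exact: mf.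
Qed.

HB.instance Definition _ := isMeasure.Build _ _ _ cons_measure
  cons_measure0 cons_measure_ge0 cons_measure_sigma_additive.

Let cons_measure_sigma_finite : sigma_finite setT cons_measure.
Proof.
have /sigma_finiteP[F [FT ndF Foo]] := sigma_finiteT m.
have /sigma_finiteP[G [GT ndG Goo]] := sigma_finiteT mu.
pose tail (t : n.+1.-tuple T) : T * n.-tuple T :=
  (tnth t ord0, [tuple of behead t]).
have mtail : measurable_fun [set: n.+1.-tuple T] tail.
  apply: measurable_fun_pair; first exact: measurable_tnth.
  exact: measurable_behead.
have consK : cancel tuple_cons tail.
  by move=> [x t]; congr pair; apply/val_inj.
exists (fun i => tail @^-1` (F i `*` G i)).
  rewrite -preimage_bigcup; apply/esym; rewrite -[RHS](preimage_setT tail).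
  congr (_ @^-1` _); apply/seteqP; split=> // -[x y] _.
  have [i _ Fx] : (\bigcup_i F i) x by rewrite -FT.
  have [j _ Gy] : (\bigcup_i G i) y by rewrite -GT.
  exists (maxn i j) => //; split.
  - by move: x Fx; exact/subsetPset/ndF/leq_maxl.
  - by move: y Gy; exact/subsetPset/ndG/leq_maxr.
move=> i; have [mF Fi] := Foo i; have [mG Gi] := Goo i; split.
  by rewrite -[X in measurable X]setTI; apply: mtail => //; exact: measurableX.
rewrite /cons_measure /pushforward.
have -> : tuple_cons @^-1` (tail @^-1` (F i `*` G i)) = F i `*` G i.
  by rewrite -comp_preimage (_ : tail \o tuple_cons = id)//; exact/funext.
by rewrite product_measure1E// lte_mul_pinfty// ge0_fin_numE.
Qed.

HB.instance Definition _ := @Measure_isSigmaFinite.Build _ _ _ cons_measure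
  cons_measure_sigma_finite.

End cons_measure.

(* Lebesgue measure on [n]-tuples as an iterated product; R^0 carries the unit
   mass. *)
Fixpoint lebesgueN (R : realType) (n : nat) :
    {sigma_finite_measure set (n.-tuple (measurableTypeR R)) -> \bar R} :=
  match n with
  | 0 => @dirac _ (0.-tuple (measurableTypeR R)) [tuple] R
  | m.+1 => cons_measure (@lebesgue_measure R) (lebesgueN R m)
  end.

(** * Calculus on R^n *)

Section calculus.
Context {R : realType} {n : nat}.

Definition partial (i : 'I_n) (f : 'rV[R]_n -> R) : 'rV[R]_n -> R :=
  fun x => 'D_(delta_mx 0 i) f x.

Definition iter_partial (s : seq 'I_n) (f : 'rV[R]_n -> R) : 'rV[R]_n -> R :=
  foldr partial f s.

(* C^oo: all iterated partial derivatives exist and are continuous. *)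
Definition smooth (f : 'rV[R]_n -> R) : Prop :=
  forall s : seq 'I_n,
    continuous (iter_partial s f) /\
    forall (i : 'I_n) (x : 'rV[R]_n),
      derivable (iter_partial s f) x (delta_mx 0 i).

Definition dot (x y : 'rV[R]_n) : R := \sum_i x 0 i * y 0 i.

End calculus.

(** * Curvature of a metric [G] given in coordinates on R^n *)

Section curvature.
Context {R : realType} {n : nat}.
Implicit Types (G : 'rV[R]_n -> 'M[R]_n) (x : 'rV[R]_n).

Definition christoffel G (k i j : 'I_n) x : R :=
  2^-1 * \sum_l invmx (G x) k l *
    (partial i (fun y => G y j l) x + partial j (fun y => G y i l) x
     - partial l (fun y => G y i j) x).

(* [riemann G l k i j] is the component R^l_{kij}, with the sign convention
   R(d_i, d_j) d_k = (D_i D_j - D_j D_i) d_k = R^l_{kij} d_l. *)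
Definition riemann G (l k i j : 'I_n) x : R :=
  partial i (christoffel G l j k) x - partial j (christoffel G l i k) x
  + \sum_m (christoffel G l i m x * christoffel G m j k x
            - christoffel G l j m x * christoffel G m i k x).

Definition ricci G x : 'M[R]_n :=
  \matrix_(j, k) \sum_i riemann G i k i j x.

(* The trace of a (0,2)-tensor with respect to [G]. *)
Definition metric_trace G (T : 'rV[R]_n -> 'M[R]_n) x : R :=
  \sum_i \sum_j invmx (G x) i j * T x i j.

Definition scalar_curv G x : R := metric_trace G (ricci G) x.

Definition ricci0 G x : 'M[R]_n := ricci G x - (scalar_curv G x / n%:R) *: G x.

(* |T|^2 = g^{ik} g^{jl} T_ij T_kl *)
Definition sqnorm2 G (T : 'rV[R]_n -> 'M[R]_n) x : R :=
  \sum_i \sum_j \sum_k \sum_l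
    invmx (G x) i k * invmx (G x) j l * T x i j * T x k l.

End curvature.

(** * Riemannian metrics on the sphere

    S^n is the unit sphere of R^(1+n), covered by the two stereographic charts
    from the poles (+1, 0) and (-1, 0); the first coordinate is the height. *)

Section sphere.
Context {R : realType} {n : nat}.
Implicit Types (p u v w : 'rV[R]_(1 + n)) (x : 'rV[R]_n).

Definition sphere : set 'rV[R]_(1 + n) := [set p | dot p p = 1].

(* T_p S^n is the orthogonal complement of [p]. *)
Definition tangent p : set 'rV[R]_(1 + n) := [set u | dot p u = 0].

(* [stereo_inv b] is the inverse of stereographic projection from the pole
   ((-1)^b, 0); it parametrises the sphere minus that pole. *)
Definition stereo_inv (b : bool) x : 'rV[R]_(1 + n) :=
  row_mx ((-1) ^+ b * (dot x x - 1) / (dot x x + 1))%:M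
         ((2 / (dot x x + 1)) *: x).

Definition stereo (b : bool) p : 'rV[R]_n :=
  (1 - (-1) ^+ b * p 0 ord0)^-1 *: rsubmx p.

Definition coord_vector (b : bool) (i : 'I_n) x : 'rV[R]_(1 + n) :=
  \row_k partial i (fun y => stereo_inv b y 0 k) x.

(* A field of bilinear forms on tangent spaces: [g p u v] is meaningful for
   [p] in the sphere and [u], [v] tangent at [p]. *)
Implicit Type g : 'rV[R]_(1 + n) -> 'rV[R]_(1 + n) -> 'rV[R]_(1 + n) -> R.

Definition chart_metric g (b : bool) x : 'M[R]_n :=
  \matrix_(i, j) g (stereo_inv b x) (coord_vector b i x) (coord_vector b j x).

Record riemannian_metric g : Prop := RiemannianMetric {
  metric_linear : forall p, sphere p ->
    forall (a : R) u v w, tangent p u -> tangent p v -> tangent p w ->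
    g p (a *: u + v) w = a * g p u w + g p v w;
  metric_sym : forall p, sphere p ->
    forall u v, tangent p u -> tangent p v -> g p u v = g p v u;
  metric_pos : forall p, sphere p ->
    forall u, tangent p u -> u != 0 -> 0 < g p u u;
  metric_smooth : forall b i j, smooth (fun x => chart_metric g b x i j)
}.

(* The value at [p] of the function on the sphere whose expression in a chart
   is [F G], for [G] the metric in that chart. [F] is meant to be a scalar
   invariant, independent of the chart: the chart from the pole (1, 0) is used, except at that pole. *)
Definition at_point (F : ('rV[R]_n -> 'M[R]_n) -> 'rV[R]_n -> R) g p : R :=
  let b := p 0 ord0 == 1 in F (chart_metric g b) (stereo b p).

Definition scalar_curvature g : 'rV[R]_(1 + n) -> R := at_point scalar_curv g.

Definition sqnorm_ricci0 g : 'rV[R]_(1 + n) -> R :=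
  at_point (fun G => sqnorm2 G (ricci0 G)) g.

(* Integral with respect to the Riemannian volume sqrt(det G) dx. The
   chart from the pole (1, 0) misses one point, which has measure zero. *)
Definition sphere_integral g (f : 'rV[R]_(1 + n) -> R) : \bar R :=
  \int[lebesgueN R n]_t
    let x := \row_i (tnth t i : R) in
    (f (stereo_inv false x) * Num.sqrt (\det (chart_metric g false x)))%:E.

Definition volume g : R := fine (sphere_integral g (fun=> 1)).

Definition average_scalar_curvature g : R :=
  fine (sphere_integral g (scalar_curvature g)) / volume g.

End sphere.

(* Main.v *)
Require Import Defs.
From HB Require Import structures.
From mathcomp Require Import all_boot all_order all_algebra.
From mathcomp Require Import all_classical all_reals all_analysis.
From mathcomp Require Import measurable_realfun ring lra.
Set Implicit Arguments.
Unset Strict Implicit.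
Unset Printing Implicit Defensive.
Import Order.TTheory GRing.Theory Num.Theory.
Import numFieldNormedType.Exports.
Local Open Scope classical_set_scope.
Local Open Scope ring_scope.

(** The counterexamples are two round spheres of different curvature joined by
    a small neck.

    A metric [psi ^ -2 g_0] conformal to the round metric [g_0], with [psi] a
    function of the height [p_0] alone, has in the stereographic chart the form
    [rho ^ -2 |dx|^2], where [rho = (1 + |x|^2) / 2 * psi]. The conformal change
    formula shows that its traceless Ricci tensor is
    [(n - 2) / rho] times the traceless Hessian of [rho]
    ([ricci0_conformal]), and for [rho = h (|x|^2)] this traceless Hessian is
    [4 h''] times the traceless part of [x x^T]. Hence the metric has constant
    curvature wherever [h] is affine in [|x|^2], which is to say wherever [psi]
    is affine in the height ([sqnorm_ricci0_profile]).

    The profile [two_spheres e] interpolates, for [y = 1 + p_0] between [e] and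
    [2 e], from an affine function of [y] that gives sectional curvature [4] to
    the constant [1], which gives sectional curvature [1]. The interpolation
    takes place where [|x|^2] is comparable to [e], where both functions are of
    order [1]. Two estimates follow.

    - On the neck the traceless Ricci tensor has square norm of order [e ^ -2],
      and the neck lies in a cube of side of order [e ^ (1/2)]. So the integral
      of the square norm is of order [e ^ (n / 2 - 2)]
      ([integral_ricci0_le]), and this tends to [0] exactly when [n >= 5].

    - On each of the two round pieces the scalar curvature is constant, equal
      to [4 n (n - 1)] or to [n (n - 1)], and each piece has volume bounded
      below independently of [e]. No real number is close to both values, so
      the integral of [(R - c)^2] is bounded below uniformly in [c] and [e]
      ([integral_scalar_deviation_ge]); the average of [R] is one such [c].

    Smoothness of the metric is proved through a class of functions [tame] that
    is stable under directional derivatives and contains the functions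
    [s ^ -k * exp (- 1 / s)] from which the cut-off is made. *)

(** * Rules for directional derivatives *)

Section chain.
Context {R : realType} {V : normedModType R}.
Implicit Types (f g : V -> R) (x v : V).

(** The rules are restated for functions written pointwise, the shape in which
    coordinates of metrics and Christoffel symbols appear. *)
Lemma is_derive_add f g x v a b : is_derive x v f a -> is_derive x v g b ->
  is_derive x v (fun y => f y + g y) (a + b).
Proof. by move=> fa gb; exact: is_deriveD. Qed.

Lemma is_derive_opp f x v a : is_derive x v f a ->
  is_derive x v (fun y => - f y) (- a).
Proof. by move=> fa; exact: is_deriveN. Qed.

Lemma is_derive_mul f g x v a b : is_derive x v f a -> is_derive x v g b ->
  is_derive x v (fun y => f y * g y) (f x * b + g x * a).
Proof. by move=> fa gb; exact: is_deriveM. Qed.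

Lemma is_derive_scale (c : R) f x v a : is_derive x v f a ->
  is_derive x v (fun y => c * f y) (c * a).
Proof. by move=> fa; exact: is_deriveZ. Qed.

Lemma is_derive_inv f x v a : f x != 0 -> is_derive x v f a ->
  is_derive x v (fun y => (f y)^-1) (- a / f x ^+ 2).
Proof.
move=> fx0 [fd <-]; apply: DeriveDef; first exact: (derivableV fx0 fd).
by rewrite deriveV// /GRing.scale/= mulrC mulNr mulrN.
Qed.

Lemma is_derive_exp f x v a k : is_derive x v f a ->
  is_derive x v (fun y => f y ^+ k) (k%:R * f x ^+ k.-1 * a).
Proof.
move=> fa; have -> : (fun y => f y ^+ k) = f ^+ k.
  by apply/funext => y; rewrite fctE.
exact: is_deriveX.
Qed.

Lemma is_derive_line f x v a :
  is_derive x v f a <-> is_derive (0 : R) 1 (fun h : R => f (h *: v + x)) a.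
Proof.
have E : 'D_1 (fun h : R => f (h *: v + x)) 0 = 'D_v f x.
  rewrite /derive; set u := fun h => h^-1 *: _; set w := fun h => h^-1 *: _.
  suff -> : u = w by [].
  by apply/funext => h; rewrite /u /w /= addr0 scale0r add0r [_%:A]mulr1.
split=> -[fd fa]; apply: DeriveDef.
- exact: (derivable1P f x v).1.
- by rewrite E.
- exact: (derivable1P f x v).2.
- by rewrite -E.
Qed.

(** Only the directional derivative of the inner function is available, not
    its differential: restricting to a line reduces to one variable. *)
Lemma is_derive_comp f (g : R -> R) x v a b :
  is_derive x v f a -> is_derive (f x) 1 g b ->
  is_derive x v (fun y => g (f y)) (b * a).
Proof.
move=> /is_derive_line fa gb; apply/is_derive_line.
apply: (@is_derive1_comp R g (fun h : R => f (h *: v + x))) => //.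
by rewrite scale0r add0r.
Qed.

End chain.

(** * Functions flat at the origin *)

Section flat.
Context {R : realType}.
Implicit Types (s : R) (k : nat).

(** The factors [s ^ -k] are included because the derivative of [exp (- 1 / s)]
    is not a multiple of it: with them the family is closed under
    differentiation. *)
Definition flat k s : R := if 0 < s then s^-1 ^+ k * expR (- s^-1) else 0.

Lemma flat_ge0 k s : 0 <= flat k s.
Proof.
rewrite /flat; case: ifPn => // s0.
by rewrite mulr_ge0 ?expR_ge0// exprn_ge0// invr_ge0 ltW.
Qed.

Lemma flat0_gt0 s : 0 < s -> 0 < flat 0 s.
Proof. by move=> s0; rewrite /flat s0 expr0 mul1r expR_gt0. Qed.

Lemma flat_le0 k s : s <= 0 -> flat k s = 0.
Proof. by rewrite leNgt /flat => /negbTE ->. Qed.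

(** The exponential series gives [exp (1 / s) >= (1 / s) ^ (k + 2) / (k + 2)!]. *)
Lemma flat_le k s : flat k s <= k.+2`!%:R * s ^+ 2.
Proof.
have [s0|s0] := ltP 0 s; last first.
  by rewrite flat_le0// mulr_ge0// ?sqr_ge0.
rewrite /flat s0 expRN ler_pdivrMr ?expR_gt0//.
have h := @expR_ge1Dxn R s^-1 k.+1 _.
have {}h : s^-1 ^+ k.+2 / k.+2`!%:R <= expR s^-1.
  by apply: le_trans (h _); rewrite ?lerDr// invr_ge0 ltW.
have F0 : 0 < k.+2`!%:R :> R by rewrite ltr0n fact_gt0.
apply: (@le_trans _ _ (k.+2`!%:R * s ^+ 2 * (s^-1 ^+ k.+2 / k.+2`!%:R))).
  rewrite -[k.+2]addn2 exprD; move: (s^-1 ^+ k) => q.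
  by rewrite le_eqVlt; apply/orP; left; apply/eqP; field; rewrite gt_eqF //= gt_eqF.
by rewrite ler_wpM2l// mulr_ge0// ?sqr_ge0// ltW.
Qed.

Lemma is_derive0_quadratic (f : R -> R) (c : R) :
  (forall s, `|f s| <= c * s ^+ 2) -> is_derive (0 : R) 1 f 0.
Proof.
move=> fc.
have f0 : f 0 = 0.
  by apply/eqP; rewrite -normr_le0 (le_trans (fc 0))// expr0n mulr0.
have c0 : 0 <= c.
  by have := le_trans (normr_ge0 _) (fc 1); rewrite expr1n mulr1.
suff h : (fun h : R => h^-1 *: ((f \o shift 0) (h *: (1 : R)) - f 0)) @ 0^' --> (0 : R).
  by apply: DeriveDef; [apply/cvg_ex; exists 0 | exact: cvg_lim].
apply/cvgrPdist_le => e e0; near=> h.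
rewrite sub0r normrN /= addr0 f0 subr0 [h%:A]mulr1 /GRing.scale /= normrM normfV.
have h0 : 0 < `|h| by rewrite normr_gt0; near: h; exact: nbhs_dnbhs_neq.
rewrite mulrC ler_pdivrMr// (le_trans (fc h))// -real_normK ?num_real//.
rewrite expr2 mulrA ler_pM2r//.
have : `|h| <= e / (c + 1).
  near: h; apply: dnbhs0_le; rewrite divr_gt0// ltr_pwDr//.
rewrite ler_pdivlMr; last lra.
by move=> H; apply: le_trans H; rewrite mulrC ler_wpM2l// lerDl.
Unshelve. all: by end_near. Qed.

(** The derivative stays in the family, which makes every member smooth; the
    quadratic bound settles the origin. *)
Lemma is_derive_flat k s :
  is_derive s 1 (flat k) (flat k.+2 s - k%:R * flat k.+1 s).
Proof.
have [s0|s0|->] := ltgtP s 0.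
- apply: (@near_eq_is_derive _ _ _ (cst 0) (flat k) s 1).
    near=> u; rewrite flat_le0// ltW//; near: u; exact: lt_nbhsl.
  by rewrite !flat_le0 ?ltW// mulr0 subr0; exact: is_derive_cst.
- apply: (@near_eq_is_derive _ _ _ (fun u : R => u^-1 ^+ k * expR (- u^-1)) (flat k) s 1).
    near=> u; rewrite /flat ifT//; near: u; exact: lt_nbhsr.
  rewrite /flat s0.
  have s00 : s != 0 by rewrite gt_eqF.
  have dV := is_derive_inv s00 (is_derive_id s 1).
  have dE := is_derive_comp (is_derive_opp dV) (is_derive_expR _).
  have dX := is_derive_exp k dV.
  apply: is_derive_eq (is_derive_mul dX dE) _.
  case: k {dX} => [|k].
    by rewrite !mul0r mulr0 !expr0; field.
  by rewrite /= !exprS; move: (s^-1 ^+ k) => q; field.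
- rewrite !flat_le0// mulr0 subr0.
  apply: (@is_derive0_quadratic _ k.+2`!%:R) => u.
  by rewrite ger0_norm ?flat_ge0//; exact: flat_le.
Unshelve. all: by end_near. Qed.

End flat.

(** * A class of smooth functions *)

Section tame.
Context {R : realType}.

(** Each generator has directional derivatives that are again built from the
    generators, so membership alone yields derivatives of every order. *)
Inductive tame (V : normedModType R) : (V -> R) -> Prop :=
| tame_cst (c : R) : tame (fun=> c)
| tame_lin (l : V -> R) : (forall a u v, l (a *: u + v) = a * l u + l v) ->
    continuous l -> tame l
| tame_add (f g : V -> R) : tame f -> tame g -> tame (fun x => f x + g x)
| tame_mul (f g : V -> R) : tame f -> tame g -> tame (fun x => f x * g x)
| tame_inv (f : V -> R) : tame f -> (forall x, f x != 0) ->
    tame (fun x => (f x)^-1)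
| tame_flat k (f : V -> R) : tame f -> tame (fun x => flat k (f x)).

Lemma is_derive_lin (V : normedModType R) (l : V -> R) (x v : V) :
  (forall a u v, l (a *: u + v) = a * l u + l v) -> is_derive x v l (l v).
Proof.
move=> lL.
suff h : h^-1 *: ((l \o shift x) (h *: v) - l x) @[h --> 0^'] --> l v.
  by apply: DeriveDef; [apply/cvg_ex; exists (l v) | exact: cvg_lim].
apply: cvg_near_cst; near=> h.
have h0 : h != 0 by near: h; exact: nbhs_dnbhs_neq.
by rewrite /= lL addrK /GRing.scale /= mulKf.
Unshelve. all: by end_near. Qed.

Lemma tame_opp (V : normedModType R) (f : V -> R) :
  tame f -> tame (fun x => - f x).
Proof.
move=> tf; have := tame_mul (tame_cst V (-1)) tf.
by congr tame; apply/funext => x; rewrite mulN1r.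
Qed.

Lemma tame_sub (V : normedModType R) (f g : V -> R) :
  tame f -> tame g -> tame (fun x => f x - g x).
Proof. by move=> tf tg; apply: tame_add => //; exact: tame_opp. Qed.

Lemma tame_exp (V : normedModType R) (f : V -> R) k :
  tame f -> tame (fun x => f x ^+ k).
Proof.
move=> tf; elim: k => [|k ih]; first exact: (tame_cst V 1).
have := tame_mul tf ih.
by congr tame; apply/funext => x; rewrite exprS.
Qed.

Lemma tame_sum (V : normedModType R) I (r : seq I) (F : I -> V -> R) :
  (forall i, tame (F i)) -> tame (fun x => \sum_(i <- r) F i x).
Proof.
move=> tF; elim: r => [|i r ih].
  have := tame_cst V 0.
  by congr tame; apply/funext => x; rewrite big_nil.
have := tame_add (tF i) ih.
by congr tame; apply/funext => x; rewrite big_cons.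
Qed.

Lemma tame_id : tame (fun s : R => s).
Proof. by apply: tame_lin => // x; exact: cvg_id. Qed.

Lemma tame_coord n (i : 'I_n) : tame (fun x : 'rV[R]_n => x 0 i).
Proof.
by apply: tame_lin => [a u v|]; [rewrite !mxE | exact: coord_continuous].
Qed.

(** The outer function lives on the line, so the induction runs on it: every
    generator on the line becomes the same generator after substitution. *)
Lemma tame_comp (V : normedModType R) (phi : R -> R) (f : V -> R) :
  tame phi -> tame f -> tame (fun x => phi (f x)).
Proof.
move=> tphi tf; elim: tphi.
- exact: tame_cst.
- move=> l lL _; have := tame_mul tf (tame_cst V (l 1)).
  congr tame; apply/funext => x.
  have l0 : l 0 = 0.
    have := lL 1 0 0; rewrite scale1r mul1r addr0 => /eqP.
    by rewrite -subr_eq subrr eq_sym => /eqP.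
  by have := lL (f x) 1 0; rewrite !addr0 l0 addr0 => <-; rewrite [_%:A]mulr1.
- by move=> g h _ tg _ th; exact: tame_add.
- by move=> g h _ tg _ th; exact: tame_mul.
- by move=> g _ tg g0; exact: tame_inv.
- by move=> k g _ tg; exact: tame_flat.
Qed.

Lemma tame_is_derive (V : normedModType R) (f : V -> R) (v : V) : tame f ->
  exists2 f', tame f' & forall x, is_derive x v f (f' x).
Proof.
elim.
- by move=> c; exists (fun=> 0); [exact: tame_cst | move=> x; exact: is_derive_cst].
- move=> l lL _; exists (fun=> l v); first exact: tame_cst.
  by move=> x; exact: is_derive_lin.
- move=> g h _ [g' tg' dg] _ [h' th' dh].
  exists (fun x => g' x + h' x); first exact: tame_add.
  by move=> x; exact: is_derive_add.
- move=> g h tg [g' tg' dg] th [h' th' dh].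
  exists (fun x => g x * h' x + h x * g' x).
    by apply: tame_add; exact: tame_mul.
  by move=> x; exact: is_derive_mul.
- move=> g tg [g' tg' dg] g0; exists (fun x => - g' x / g x ^+ 2).
    apply: tame_mul; first exact: tame_opp.
    by apply: tame_inv => [|x]; [exact: tame_exp | rewrite expf_neq0].
  by move=> x; exact: is_derive_inv.
- move=> k g tg [g' tg' dg].
  exists (fun x => (flat k.+2 (g x) - k%:R * flat k.+1 (g x)) * g' x).
    apply: tame_mul => //; apply: tame_sub; first exact: tame_flat.
    by apply: tame_mul; [exact: tame_cst | exact: tame_flat].
  by move=> x; apply: is_derive_comp => //; exact: is_derive_flat.
Qed.

Lemma flat_continuous k : continuous (@flat R k).
Proof.
move=> s; apply/differentiable_continuous/derivable1_diffP.
by have [] := is_derive_flat k s.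
Qed.

Lemma tame_continuous (V : normedModType R) (f : V -> R) :
  tame f -> continuous f.
Proof.
elim=> {f}.
- by move=> c x; exact: cvg_cst.
- by [].
- by move=> f g _ cf _ cg x; apply: cvgD; [exact: cf | exact: cg].
- by move=> f g _ cf _ cg x; apply: cvgM; [exact: cf | exact: cg].
- by move=> f _ cf f0 x; apply: cvgV; [exact: f0 | exact: cf].
- move=> k f _ cf x.
  by apply: (@continuous_comp _ _ _ f (flat k)); [exact: cf | exact: flat_continuous].
Qed.

Lemma tame_smooth n (f : 'rV[R]_n -> R) : tame f -> smooth f.
Proof.
move=> tf s.
have ts : tame (iter_partial s f).
  elim: s => //= i s ih.
  have [f' tf' df] := tame_is_derive (delta_mx 0 i) ih.
  by congr tame: tf'; apply/funext => x; rewrite /partial derive_val.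
split=> [|i x]; first exact: tame_continuous.
by have [f' _ df] := tame_is_derive (delta_mx 0 i) ts; have [] := df x.
Qed.

End tame.

(** * Curvature of a conformally flat metric *)

Section conformally_flat.
Context {R : realType} {n : nat}.
Variables (rho : 'rV[R]_n -> R) (d : 'I_n -> 'rV[R]_n -> R)
  (dd : 'I_n -> 'I_n -> 'rV[R]_n -> R).
Hypothesis rho_neq0 : forall x, rho x != 0.
Hypothesis rho_d : forall i x, is_derive x (delta_mx 0 i) rho (d i x).
Hypothesis d_dd : forall i j x, is_derive x (delta_mx 0 j) (d i) (dd i j x).
Hypothesis dd_sym : forall i j x, dd i j x = dd j i x.

Let G (x : 'rV[R]_n) : 'M[R]_n := ((rho x)^-1 ^+ 2)%:M.
Let a i x := - d i x / rho x.
Let b l i x := - dd i l x / rho x + d i x * d l x / rho x ^+ 2.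
Let delta (i j : 'I_n) : R := (i == j)%:R.

Let delta_sym i j : delta i j = delta j i.
Proof. by rewrite /delta eq_sym. Qed.

Let sum_deltal (i : 'I_n) (F : 'I_n -> R) : \sum_m delta i m * F m = F i.
Proof.
rewrite (bigD1 i)//= /delta eqxx mul1r big1 ?addr0// => m mi.
by rewrite eq_sym (negbTE mi) mul0r.
Qed.

Let sum_deltar (i : 'I_n) (F : 'I_n -> R) : \sum_m delta m i * F m = F i.
Proof. by under eq_bigr do rewrite delta_sym; exact: sum_deltal. Qed.

Let GE x i j : G x i j = delta i j * (rho x)^-1 ^+ 2.
Proof. by rewrite /G mxE mulr_natl. Qed.

Let invGE x i j : invmx (G x) i j = delta i j * rho x ^+ 2.
Proof. by rewrite /G invmx_scalar mxE exprVn invrK mulr_natl. Qed.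

Let partial_G x l i j :
  partial l (fun y => G y i j) x = delta i j * (2 * a l x * (rho x)^-1 ^+ 2).
Proof.
have h : is_derive x (delta_mx 0 l) (fun y => G y i j)
    (delta i j * (2 * a l x * (rho x)^-1 ^+ 2)).
  have -> : (fun y => G y i j) = (fun y => delta i j * (rho y)^-1 ^+ 2).
    by apply/funext => y; rewrite GE.
  have h0 := is_derive_exp 2 (is_derive_inv (rho_neq0 x) (rho_d l x)).
  apply: is_derive_eq (is_derive_scale (delta i j) h0) _.
  by rewrite /a /=; field.
by rewrite /partial derive_val.
Qed.

Let christoffelE k i j :
  christoffel G k i j =
  (fun x => delta k j * a i x + delta k i * a j x - delta i j * a k x).
Proof.
apply/funext => x; rewrite /christoffel.
under eq_bigr do rewrite invGE !partial_G -[_ * rho x ^+ 2 * _]mulrA.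
rewrite sum_deltal [delta j k]delta_sym [delta i k]delta_sym; field.
exact: rho_neq0.
Qed.

Let is_derive_a l i x : is_derive x (delta_mx 0 l) (a i) (b l i x).
Proof.
have h := is_derive_mul (is_derive_opp (d_dd i l x))
  (is_derive_inv (rho_neq0 x) (rho_d l x)).
apply: is_derive_eq h _; rewrite /b; field; exact: rho_neq0.
Qed.

Let partial_christoffel l k i j x : partial l (christoffel G k i j) x =
  delta k j * b l i x + delta k i * b l j x - delta i j * b l k x.
Proof.
have h : is_derive x (delta_mx 0 l) (christoffel G k i j)
    (delta k j * b l i x + delta k i * b l j x - delta i j * b l k x).
  rewrite christoffelE.
  have m c i' := is_derive_scale c (is_derive_a l i' x).
  exact: is_derive_add (is_derive_add (m _ _) (m _ _)) (is_derive_opp (m _ _)).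
by rewrite /partial derive_val.
Qed.

(** With [a] the differential of [f = - log rho] and [b] its Hessian, this is
    the classical formula for the Ricci tensor of [exp (2 f) |dx|^2]. *)
Let ricci_a x j k : ricci G x j k =
  - (n%:R - 2) * (b j k x - a j x * a k x)
  - delta j k * (\sum_i b i i x + (n%:R - 2) * \sum_i a i x ^+ 2).
Proof.
have bs i l : b i l x = b l i x by rewrite /b dd_sym [d l x * _]mulrC.
have contract i l : \sum_m a m x * christoffel G m i l x =
    2 * a i x * a l x - delta i l * \sum_m a m x ^+ 2.
  under eq_bigr => m _.
    rewrite christoffelE.
    have -> : a m x * (delta m l * a i x + delta m i * a l x - delta i l * a m x)
      = delta m l * (a m x * a i x) + delta m i * (a m x * a l x)
        - delta i l * (a m x ^+ 2) by ring.
    over.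
  rewrite sumrB big_split/= !sum_deltar mulr_sumr; ring.
have contract' : \sum_i a i x * christoffel G j i k x =
    delta j k * \sum_i a i x ^+ 2.
  under eq_bigr => i _.
    rewrite christoffelE.
    have -> : a i x * (delta j k * a i x + delta j i * a k x - delta i k * a j x)
      = delta j k * a i x ^+ 2 + delta j i * (a i x * a k x)
        - delta i k * (a i x * a j x) by ring.
    over.
  by rewrite sumrB big_split/= sum_deltal sum_deltar mulr_sumr; ring.
have trace m : \sum_i christoffel G i i m x = n%:R * a m x.
  under eq_bigr => i _.
    rewrite christoffelE /delta eqxx.
    have -> : (i == m)%:R * a i x + true%:R * a m x - (i == m)%:R * a i x = a m x
      by rewrite mul1r; ring.
    over.
  by rewrite sumr_const card_ord mulr_natl.
have quad i : \sum_m christoffel G i j m x * christoffel G m i k x =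
    a j x * a k x + delta i j * (2 * a i x * a k x - delta i k * \sum_m a m x ^+ 2)
    - a i x * christoffel G j i k x.
  under eq_bigr => m _.
    rewrite [christoffel G i j m]christoffelE.
    have -> : (delta i m * a j x + delta i j * a m x - delta j m * a i x) *
      christoffel G m i k x = delta i m * (a j x * christoffel G m i k x)
      + delta i j * (a m x * christoffel G m i k x)
      - delta j m * (a i x * christoffel G m i k x) by ring.
    over.
  rewrite sumrB big_split/= !sum_deltal -mulr_sumr contract.
  congr (_ + _ - _); rewrite christoffelE /delta eqxx mul1r; ring.
rewrite mxE /riemann [LHS]big_split [X in X + _ = _]big_split /=.
have -> : \sum_i partial i (christoffel G i j k) x =
    2 * b j k x - delta j k * \sum_i b i i x.
  under eq_bigr do rewrite partial_christoffel.
  rewrite sumrB big_split/= !sum_deltar mulr_sumr [b k j x]bs; ring.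
have -> : \sum_i - partial j (christoffel G i i k) x = - (n%:R * b j k x).
  rewrite sumrN; congr (- _).
  under eq_bigr => i _.
    rewrite partial_christoffel /delta eqxx.
    have -> : (i == k)%:R * b j i x + true%:R * b j k x - (i == k)%:R * b j i x
      = b j k x by rewrite mul1r; ring.
    over.
  by rewrite sumr_const card_ord mulr_natl.
have -> : \sum_i \sum_m (christoffel G i i m x * christoffel G m j k x
    - christoffel G i j m x * christoffel G m i k x)
  = n%:R * (2 * a j x * a k x - delta j k * \sum_m a m x ^+ 2)
    - ((n%:R + 2) * (a j x * a k x) - 2 * (delta j k * \sum_m a m x ^+ 2)).
  under eq_bigr do rewrite sumrB.
  rewrite sumrB; congr (_ - _).
    rewrite exchange_big/= -contract mulr_sumr; apply: eq_bigr => m _.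
    by rewrite -mulr_suml trace mulrA.
  under eq_bigr do rewrite quad.
  rewrite sumrB big_split/= sumr_const card_ord sum_deltar contract' -mulr_natl.
  ring.
ring.
Qed.

Let lap x := \sum_i dd i i x.
Let grad2 x := \sum_i d i x ^+ 2.

(** In terms of [rho] rather than [log rho] the terms quadratic in the gradient
    cancel off the diagonal: [b - a a^T = - dd / rho]. *)
Lemma ricci_conformal x j k : ricci G x j k =
  (n%:R - 2) * dd j k x / rho x
  + delta j k * (lap x / rho x - (n%:R - 1) * grad2 x / rho x ^+ 2).
Proof.
rewrite ricci_a.
have -> : \sum_i b i i x = - lap x / rho x + grad2 x / rho x ^+ 2.
  rewrite big_split/= /lap /grad2 -!mulr_suml; congr (_ / _ + _).
  by rewrite sumrN.
have -> : \sum_i a i x ^+ 2 = grad2 x / rho x ^+ 2.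
  rewrite /grad2 mulr_suml; apply: eq_bigr => i _.
  by rewrite /a expr_div_n sqrrN.
rewrite /b /a [dd k j x]dd_sym; field; exact: rho_neq0.
Qed.

Lemma scalar_curv_conformal x : scalar_curv G x =
  2 * (n%:R - 1) * rho x * lap x - n%:R * (n%:R - 1) * grad2 x.
Proof.
rewrite /scalar_curv /metric_trace.
under eq_bigr => i _.
  under eq_bigr do rewrite invGE -[_ * rho x ^+ 2 * _]mulrA.
  rewrite sum_deltal ricci_conformal /delta eqxx mul1r mulrDr. over.
rewrite big_split/= sumr_const card_ord -mulr_natl.
under eq_bigr do rewrite -mulrA mulrCA [_ / rho x]mulrC.
rewrite -mulr_sumr -!mulr_sumr -/(lap x); field; exact: rho_neq0.
Qed.

(** The gradient terms of the Ricci tensor are multiples of the metric, so only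
    the Hessian survives in the traceless part. *)
Lemma ricci0_conformal x j k : (0 < n)%N -> ricci0 G x j k =
  (n%:R - 2) / rho x * (dd j k x - lap x / n%:R * delta j k).
Proof.
move=> n0; rewrite /ricci0 mxE ricci_conformal mxE mxE GE scalar_curv_conformal.
have nR : n%:R != 0 :> R by rewrite pnatr_eq0 -lt0n.
field; rewrite nR; exact: rho_neq0.
Qed.

Lemma sqnorm_ricci0_conformal x : (0 < n)%N -> sqnorm2 G (ricci0 G) x =
  (n%:R - 2) ^+ 2 * rho x ^+ 2 *
  \sum_i \sum_j (dd i j x - lap x / n%:R * (i == j)%:R) ^+ 2.
Proof.
move=> n0; rewrite /sqnorm2 mulr_sumr; apply: eq_bigr => i _.
rewrite mulr_sumr; apply: eq_bigr => j _.
under eq_bigr => k _.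
  under eq_bigr => l _.
    rewrite !invGE.
    have -> : delta i k * rho x ^+ 2 * (delta j l * rho x ^+ 2) * ricci0 G x i j
        * ricci0 G x k l = delta j l * (delta i k *
        (rho x ^+ 4 * ricci0 G x i j * ricci0 G x k l)) by ring.
    over.
  rewrite sum_deltal. over.
rewrite sum_deltal ricci0_conformal//.
rewrite -/(delta i j); move: (dd i j x - _) => q; field; exact: rho_neq0.
Qed.

End conformally_flat.

(** * Radial conformal factors *)

Section radial.
Context {R : realType} {n : nat}.
Implicit Types (x : 'rV[R]_n).

Lemma dot_ge0 m (x : 'rV[R]_m) : 0 <= dot x x.
Proof. by apply: sumr_ge0 => i _; rewrite -expr2 sqr_ge0. Qed.

Lemma dotp1_gt0 x : 0 < dot x x + 1.
Proof. by rewrite ltr_pwDr// dot_ge0. Qed.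

Lemma is_derive_coord x (i j : 'I_n) :
  is_derive x (delta_mx 0 i) (fun y : 'rV[R]_n => y 0 j) (j == i)%:R.
Proof.
have -> : (j == i)%:R = (delta_mx 0 i : 'rV[R]_n) 0 j by rewrite mxE eqxx.
by apply: is_derive_lin => a u v; rewrite !mxE.
Qed.

Lemma is_derive_dot x (i : 'I_n) :
  is_derive x (delta_mx 0 i) (fun y : 'rV[R]_n => dot y y) (2 * x 0 i).
Proof.
have -> : (fun y : 'rV[R]_n => dot y y) =
    \sum_(j < n) (fun y : 'rV[R]_n => y 0 j * y 0 j).
  by apply/funext => y; rewrite /dot fct_sumE.
have -> : 2 * x 0 i =
    \sum_(j < n) (x 0 j * (j == i)%:R + x 0 j * (j == i)%:R).
  rewrite (bigD1 i)//= eqxx big1 ?addr0 => [|j /negbTE->] /=; first ring.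
  by rewrite mulr0 addr0.
apply: is_derive_sum => j; apply: is_derive_mul; exact: is_derive_coord.
Qed.

Lemma tame_dot : tame (fun x : 'rV[R]_n => dot x x).
Proof. by apply: tame_sum => i; apply: tame_mul; exact: tame_coord. Qed.

Section hessian.
Variables h h1 h2 : R -> R.
Hypothesis h_neq0 : forall t : R, 0 <= t -> h t != 0.
Hypothesis dh : forall t : R, 0 <= t -> is_derive t 1 h (h1 t).
Hypothesis dh1 : forall t : R, 0 <= t -> is_derive t 1 h1 (h2 t).

Let rho x := h (dot x x).
Let d (i : 'I_n) x := h1 (dot x x) * (2 * x 0 i).
Let dd (i j : 'I_n) x :=
  h1 (dot x x) * (2 * (i == j)%:R) + 2 * x 0 i * (h2 (dot x x) * (2 * x 0 j)).

Let rho_neq0 x : rho x != 0. Proof. exact/h_neq0/dot_ge0. Qed.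

Let rho_d i x : is_derive x (delta_mx 0 i) rho (d i x).
Proof.
by apply: is_derive_comp; [exact: is_derive_dot | exact/dh/dot_ge0].
Qed.

Let d_dd i j x : is_derive x (delta_mx 0 j) (d i) (dd i j x).
Proof.
apply: is_derive_mul; last exact/is_derive_scale/is_derive_coord.
by apply: is_derive_comp; [exact: is_derive_dot | exact/dh1/dot_ge0].
Qed.

Let dd_sym i j x : dd i j x = dd j i x.
Proof. by rewrite /dd eq_sym; ring. Qed.

Let lapE x : \sum_i dd i i x =
  2 * n%:R * h1 (dot x x) + 4 * dot x x * h2 (dot x x).
Proof.
rewrite big_split/=; congr (_ + _).
  by under eq_bigr do rewrite eqxx mulr1; rewrite sumr_const card_ord -mulr_natl; ring.
rewrite [in X in _ * X * _]/dot mulr_sumr mulr_suml.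
by apply: eq_bigr => i _; ring.
Qed.

Lemma scalar_curv_radial x :
  scalar_curv (fun y => ((h (dot y y))^-1 ^+ 2)%:M) x =
  let t := dot x x in
  4 * (n%:R - 1) * (n%:R * h1 t * (h t - t * h1 t) + 2 * t * h t * h2 t).
Proof.
rewrite (scalar_curv_conformal rho_neq0 rho_d d_dd dd_sym) lapE /=.
have -> : \sum_i d i x ^+ 2 = 4 * dot x x * h1 (dot x x) ^+ 2.
  rewrite [in X in _ * X * _]/dot mulr_sumr mulr_suml.
  by apply: eq_bigr => i _; rewrite /d; ring.
rewrite /rho; ring.
Qed.

(** The Hessian is [2 h' I + 4 h'' x x^T], and [x x^T - (t / n) I] has square
    norm [t ^ 2 (1 - 1 / n)]; in particular an affine [h] gives an Einstein
    metric. *)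
Lemma sqnorm_ricci0_radial x : (0 < n)%N ->
  sqnorm2 (fun y => ((h (dot y y))^-1 ^+ 2)%:M)
    (ricci0 (fun y => ((h (dot y y))^-1 ^+ 2)%:M)) x =
  let t := dot x x in
  16 * (n%:R - 2) ^+ 2 * (1 - n%:R^-1) * (t * h t * h2 t) ^+ 2.
Proof.
move=> n0; have nR : n%:R != 0 :> R by rewrite pnatr_eq0 -lt0n.
rewrite (sqnorm_ricci0_conformal rho_neq0 rho_d d_dd dd_sym)// lapE /=.
set t := dot x x.
have -> : \sum_i \sum_j (dd i j x - (2 * n%:R * h1 t + 4 * t * h2 t) / n%:R *
    (i == j)%:R) ^+ 2 = 16 * h2 t ^+ 2 * (t ^+ 2 - t ^+ 2 / n%:R).
  transitivity (16 * h2 t ^+ 2 * \sum_i (x 0 i ^+ 2 * t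
      + (- 2 * t / n%:R * x 0 i ^+ 2 + t ^+ 2 / n%:R ^+ 2))).
    rewrite mulr_sumr; apply: eq_bigr => i _.
    transitivity (16 * h2 t ^+ 2 * \sum_j (x 0 i ^+ 2 * x 0 j ^+ 2 +
        (i == j)%:R * (- 2 * t / n%:R * x 0 i * x 0 j + t ^+ 2 / n%:R ^+ 2))).
      rewrite mulr_sumr; apply: eq_bigr => j _; rewrite /dd -/t.
      by case: eqP => _ /=; field.
    congr (_ * _); rewrite big_split/= -mulr_sumr; congr (_ * _ + _).
    rewrite (bigD1 i)//= eqxx big1 ?addr0 => [|j /negbTE ji] /=; first ring.
    by rewrite eq_sym ji mul0r.
  congr (_ * _); rewrite !big_split/= -mulr_suml -mulr_sumr.
  have -> : \sum_i x 0 i ^+ 2 = t by rewrite /t; apply: eq_bigr => i _; rewrite expr2.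
  by rewrite sumr_const card_ord -mulr_natl; field.
by rewrite /rho -/t; field.
Qed.

End hessian.
End radial.

(** * Conformal metrics on the sphere in stereographic charts *)

Section stereographic.
Context {R : realType} {n : nat}.
Implicit Types (b : bool) (x : 'rV[R]_n).

Definition height b x : R := (-1) ^+ b * (dot x x - 1) / (dot x x + 1).

Lemma stereo_invl b x (i : 'I_1) : stereo_inv b x 0 (lshift n i) = height b x.
Proof. by rewrite row_mxEl ord1 mxE eqxx mulr1n. Qed.

Lemma stereo_invr b x i :
  stereo_inv b x 0 (rshift 1 i) = 2 / (dot x x + 1) * x 0 i.
Proof. by rewrite row_mxEr mxE. Qed.

Lemma stereo_inv0 b x : stereo_inv b x 0 ord0 = height b x.
Proof.
rewrite -(stereo_invl b x ord0); congr (stereo_inv b x 0 _); exact: val_inj.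
Qed.

Lemma stereoK x : stereo false (stereo_inv false x) = x.
Proof.
apply/rowP => i; rewrite mxE [rsubmx _ _ _]mxE stereo_invr stereo_inv0 /height.
have := dotp1_gt0 x; move: (dot x x) => t t0.
by rewrite expr0 mul1r; field; apply/andP; split; lra.
Qed.

Lemma height_neq1 x : height false x != 1.
Proof.
rewrite /height expr0 mul1r.
have := dotp1_gt0 x; move: (dot x x) => t t0.
by apply/eqP => /(congr1 ( *%R^~ (t + 1))); rewrite divfK ?gt_eqF//; lra.
Qed.

Lemma at_point_stereo (F : ('rV[R]_n -> 'M[R]_n) -> 'rV[R]_n -> R) g x :
  at_point F g (stereo_inv false x) = F (chart_metric g false) x.
Proof. by rewrite /at_point stereo_inv0 (negbTE (height_neq1 x)) stereoK. Qed.

Let is_derive_inv_dot x (i : 'I_n) :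
  is_derive x (delta_mx 0 i) (fun y : 'rV[R]_n => (dot y y + 1)^-1)
    (- (2 * x 0 i) / (dot x x + 1) ^+ 2).
Proof.
apply: is_derive_inv; first by rewrite gt_eqF ?dotp1_gt0.
by have := is_derive_add (is_derive_dot x i) (is_derive_cst (1 : R) x _);
  rewrite addr0.
Qed.

Lemma coord_vectorl b i x (j : 'I_1) : coord_vector b i x 0 (lshift n j) =
  (-1) ^+ b * 4 * x 0 i / (dot x x + 1) ^+ 2.
Proof.
rewrite mxE.
have -> : (fun y : 'rV[R]_n => stereo_inv b y 0 (lshift n j)) =
    (fun y : 'rV[R]_n => (-1) ^+ b + (-1) ^+ b * -2 * (dot y y + 1)^-1).
  apply/funext => y; rewrite stereo_invl /height.
  by have := dotp1_gt0 y; move: (dot y y) => t t0; field; lra.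
have h := is_derive_add (is_derive_cst ((-1) ^+ b : R) x (delta_mx 0 i))
  (is_derive_scale ((-1) ^+ b * -2) (is_derive_inv_dot x i)).
rewrite /partial derive_val; have := dotp1_gt0 x; move: (dot x x) => t t0.
by field; lra.
Qed.

Lemma coord_vectorr b i x (j : 'I_n) : coord_vector b i x 0 (rshift 1 j) =
  2 / (dot x x + 1) * (j == i)%:R - 4 * x 0 i * x 0 j / (dot x x + 1) ^+ 2.
Proof.
rewrite mxE.
have -> : (fun y : 'rV[R]_n => stereo_inv b y 0 (rshift 1 j)) =
    (fun y => 2 * ((dot y y + 1)^-1 * y 0 j)).
  by apply/funext => y; rewrite stereo_invr mulrA.
have h := is_derive_scale 2
  (is_derive_mul (is_derive_inv_dot x i) (is_derive_coord x i j)).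
rewrite /partial derive_val; have := dotp1_gt0 x; move: (dot x x) => t t0.
by field; lra.
Qed.

(** Stereographic projection is conformal. *)
Lemma dot_coord_vector b i j x :
  dot (coord_vector b i x) (coord_vector b j x) =
  (i == j)%:R * (2 / (dot x x + 1)) ^+ 2.
Proof.
rewrite {1}/dot big_split_ord/= big_ord1 !coord_vectorl.
under eq_bigr do rewrite !coord_vectorr.
set t := dot x x; have t0 : t + 1 != 0 by rewrite gt_eqF ?dotp1_gt0.
have -> : \sum_k (2 / (t + 1) * (k == i)%:R - 4 * x 0 i * x 0 k / (t + 1) ^+ 2) *
    (2 / (t + 1) * (k == j)%:R - 4 * x 0 j * x 0 k / (t + 1) ^+ 2) =
  4 / (t + 1) ^+ 2 * (i == j)%:R - 16 * x 0 i * x 0 j / (t + 1) ^+ 3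
  + 16 * x 0 i * x 0 j / (t + 1) ^+ 4 * t.
  transitivity (\sum_k ((k == i)%:R * (4 / (t + 1) ^+ 2 * (i == j)%:R
       - 8 * x 0 i * x 0 j / (t + 1) ^+ 3)
     + (k == j)%:R * (- 8 * x 0 i * x 0 j / (t + 1) ^+ 3)
     + 16 * x 0 i * x 0 j / (t + 1) ^+ 4 * (x 0 k * x 0 k))).
    apply: eq_bigr => k _.
    have [->|ki] := eqVneq k i; first by case: eqVneq => [->|_] /=; field.
    have [<-|_] := eqVneq k j; last by case: (i == j) => /=; field.
    by rewrite eq_sym (negbTE ki) /=; field.
  rewrite 2!big_split/= -!mulr_suml -mulr_sumr -/(dot x x) -/t.
  have one l : \sum_(k < n) (k == l)%:R = 1 :> R.
    by rewrite (bigD1 l)//= eqxx big1 ?addr0// => k /negbTE->.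
  by rewrite !one; field.
have -> : (-1) ^+ b * 4 * x 0 i / (t + 1) ^+ 2 * ((-1) ^+ b * 4 * x 0 j / (t + 1) ^+ 2)
   = 16 * x 0 i * x 0 j / (t + 1) ^+ 4.
  by case: b; rewrite ?expr0 ?expr1; field.
by field.
Qed.

Lemma dot_stereo_inv b x : dot (stereo_inv b x) (stereo_inv b x) = 1.
Proof.
rewrite {1}/dot big_split_ord/= big_ord1 !stereo_invl.
under eq_bigr do rewrite !stereo_invr.
set t := dot x x; have t0 : t + 1 != 0 by rewrite gt_eqF ?dotp1_gt0.
have -> : \sum_i 2 / (t + 1) * x 0 i * (2 / (t + 1) * x 0 i) = (2 / (t + 1)) ^+ 2 * t.
  by rewrite /t /dot mulr_sumr; apply: eq_bigr => i _; ring.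
by rewrite /height -/t; case: b; rewrite ?expr0 ?expr1; field.
Qed.

(** The argument of [psi] is [1 + p 0 ord0], the height above the pole
    [(-1, 0)], which is the centre of the chart [stereo_inv false]. *)
Definition conformal_metric (psi : R -> R)
    (p u v : 'rV[R]_(1 + n)) : R := (psi (1 + p 0 ord0))^-1 ^+ 2 * dot u v.

Definition conformal_factor (psi : R -> R) b x : R :=
  (dot x x + 1) / 2 * psi (1 + height b x).

Lemma chart_conformal_metric psi b x :
  chart_metric (conformal_metric psi) b x =
  ((conformal_factor psi b x)^-1 ^+ 2)%:M.
Proof.
apply/matrixP => i j; rewrite mxE /conformal_metric stereo_inv0 dot_coord_vector.
rewrite [RHS]mxE -[RHS]mulr_natl mulrCA -!exprMn /conformal_factor invfM invf_div.
by rewrite [_ * (2 / _)]mulrC.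
Qed.

Lemma riemannian_conformal_metric (psi : R -> R) :
  (forall y, 0 <= y <= 2 -> psi y != 0) -> tame psi ->
  riemannian_metric (conformal_metric psi).
Proof.
move=> psi0 tpsi.
have psi_neq0 p : sphere p -> psi (1 + p 0 ord0) != 0.
  rewrite /sphere /= /dot (bigD1 ord0)//= => p1.
  have : p 0 ord0 ^+ 2 <= 1.
    rewrite -p1 expr2 lerDl; apply: sumr_ge0 => i _.
    by rewrite -expr2 sqr_ge0.
  by move: (p 0 ord0) => z z1; apply: psi0; nra.
split.
- move=> p _ a u v w _ _ _; rewrite /conformal_metric.
  have -> : dot (a *: u + v) w = a * dot u w + dot v w.
    rewrite /dot mulr_sumr -big_split; apply: eq_bigr => i _ /=.
    by rewrite !mxE; ring.
  ring.
- move=> p _ u v _ _; rewrite /conformal_metric; congr (_ * _).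
  by apply: eq_bigr => i _; rewrite mulrC.
- move=> p sp u _ u0; apply: mulr_gt0.
    by rewrite lt_neqAle sqr_ge0 andbT eq_sym expf_neq0// invr_eq0 psi_neq0.
  rewrite lt_neqAle dot_ge0 andbT eq_sym; apply: contra u0 => /eqP u0.
  apply/eqP/rowP => i; rewrite mxE; apply/eqP; rewrite -sqrf_eq0 expr2.
  move/eqP: u0; rewrite psumr_eq0 => [/allP/(_ i)|j _]; last first.
    by rewrite -expr2 sqr_ge0.
  by rewrite mem_index_enum => /(_ isT).
- move=> b i j; apply: tame_smooth.
  have -> : (fun x => chart_metric (conformal_metric psi) b x i j) =
      (fun x => (i == j)%:R * (conformal_factor psi b x)^-1 ^+ 2).
    by apply/funext => x; rewrite chart_conformal_metric mxE mulr_natl.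
  apply: tame_mul; first exact: tame_cst.
  have td : tame (fun x : 'rV[R]_n => dot x x + 1).
    by apply: tame_add; [exact: tame_dot | exact: tame_cst].
  apply: tame_exp; apply: tame_inv => [|x]; last first.
    rewrite /conformal_factor mulf_neq0//.
      by rewrite gt_eqF// divr_gt0 ?dotp1_gt0.
    by rewrite -stereo_inv0; apply: psi_neq0; exact: dot_stereo_inv.
  rewrite /conformal_factor /height.
  apply: tame_mul; first by apply: tame_mul => //; exact: tame_cst.
  apply: tame_comp => //; apply: tame_add; first exact: tame_cst.
  apply: tame_mul; last first.
    by apply: tame_inv => // x; rewrite gt_eqF ?dotp1_gt0.
  apply: tame_mul; first exact: tame_cst.
  by apply: tame_sub; [exact: tame_dot | exact: tame_cst].
Qed.

End stereographic.

(** * Integrals over cubes *)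

Section cube.
Context {R : realType}.

(** The integral of a nonnegative function is a supremum over the simple
    functions below it, and this supremum is monotone in the function. *)
Lemma ge0_le_integralT d (T : measurableType d) (mu : {measure set T -> \bar R})
    (f g : T -> \bar R) : (forall x, (0 <= f x)%E) ->
  (forall x, (f x <= g x)%E) -> (\int[mu]_x f x <= \int[mu]_x g x)%E.
Proof.
move=> f0 fg; have g0 x : (0 <= g x)%E by apply: le_trans (fg x).
rewrite !ge0_integralTE//; apply: ereal_sup_le => _ [h hf <-].
by exists h => // x; apply: le_trans (fg x).
Qed.

Definition cube n (a b : R) : set (n.-tuple (measurableTypeR R)) :=
  [set t | forall i, a <= (tnth t i : R) <= b].
Arguments cube : clear implicits.

Lemma measurable_cube n a b : measurable (cube n a b).
Proof.
have -> : cube n a b = \bigcap_(i in [set: 'I_n]) ((fun t => tnth t i) @^-1` `[a, b]%classic).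
  apply/seteqP; split=> [t /= tab i _|t /= tab i] /=.
    by rewrite in_itv/= tab.
  by have := tab i I; rewrite /= in_itv.
apply: fin_bigcap_measurable => // i _.
rewrite -[X in measurable X]setTI; exact: measurable_tnth.
Qed.

Lemma lebesgueN_cube n a b : a <= b ->
  lebesgueN R n (cube n a b) = ((b - a) ^+ n)%:E.
Proof.
move=> ab; elim: n => [|n ih].
  by rewrite /= diracE expr0 mem_set// => -[].
rewrite /= /cons_measure /pushforward.
have -> : @tuple_cons _ _ n @^-1` (cube n.+1 a b) = `[a, b]%classic `*` cube n a b.
  apply/seteqP; split=> [[x t] /= tab|[x t] /= [xab tab] i].
    split; first by rewrite in_itv/=; exact: (tab ord0).
    by move=> i; have := tab (lift ord0 i); rewrite tnthS.
  have [j ->|->] := unliftP ord0 i; first by rewrite tnthS.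
  by rewrite tnth0; move: xab; rewrite in_itv.
rewrite product_measure1E ?ih//; last exact: measurable_cube.
rewrite [X in (X * _)%E](lebesgue_measure_itv `[a, b])/= lte_fin exprS EFinM.
by case: ltgtP ab => // -> _; rewrite subrr.
Qed.

Lemma integral_cst_cube n a b (k : R) : a <= b -> 0 <= k ->
  (\int[lebesgueN R n]_t (k * \1_(cube n a b) t)%:E)%E = (k * (b - a) ^+ n)%:E.
Proof.
move=> ab k0; have mc := @measurable_cube n a b.
under eq_integral do rewrite EFinM.
rewrite ge0_integralZl//.
- by rewrite integral_indic// setIT [X in (_ * X)%E](lebesgueN_cube n ab).
- by apply/measurable_EFinP; exact: measurable_indic.
Qed.

Lemma integral_le_cube n a b k (f : n.-tuple (measurableTypeR R) -> R) :
  a <= b -> 0 <= k -> (forall t, 0 <= f t) ->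
  (forall t, f t <= k) -> (forall t, ~ cube n a b t -> f t = 0) ->
  (\int[lebesgueN R n]_t (f t)%:E <= (k * (b - a) ^+ n)%:E)%E.
Proof.
move=> ab k0 f0 fk fc; rewrite -integral_cst_cube//.
apply: ge0_le_integralT => t; rewrite lee_fin// indicE.
have [tc|tc] := boolP (t \in _); first by rewrite mulr1.
by rewrite fc ?mulr0// => tc'; move/negP: tc; apply; rewrite inE.
Qed.

Lemma integral_ge_cube n a b k (f : n.-tuple (measurableTypeR R) -> R) :
  a <= b -> 0 <= k -> (forall t, 0 <= f t) ->
  (forall t, cube n a b t -> k <= f t) ->
  ((k * (b - a) ^+ n)%:E <= \int[lebesgueN R n]_t (f t)%:E)%E.
Proof.
move=> ab k0 f0 fk; rewrite -integral_cst_cube//.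
apply: ge0_le_integralT => t; rewrite lee_fin indicE ?mulr_ge0//.
have [/set_mem tc|tc] := boolP (t \in _); first by rewrite mulr1 fk.
by rewrite mulr0.
Qed.

End cube.
Arguments cube {R} n a b t.

(** * Metrics whose conformal factor depends on the height *)

Section profile_curvature.
Context {R : realType} {n : nat}.
Variables psi psi1 psi2 : R -> R.
Hypothesis psi_gt0 : forall y : R, 0 <= y <= 2 -> 0 < psi y.
Hypothesis dpsi : forall y : R, is_derive y 1 psi (psi1 y).
Hypothesis dpsi1 : forall y : R, is_derive y 1 psi1 (psi2 y).
Implicit Types (t : R) (x : 'rV[R]_n).

(** This is [1 + height false x] as a function of [t = dot x x]. *)
Definition latitude t : R := 2 * t / (t + 1).

Definition radial_factor t : R := (t + 1) / 2 * psi (latitude t).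

(* The derivatives of [radial_factor]. In the second one the two terms in [psi1]
   cancel, because [radial_factor] is the pull-back of [psi] under a projective
   change of variable; so affine profiles give affine radial factors. *)
Let h1 t := psi (latitude t) / 2 + psi1 (latitude t) / (t + 1).
Let h2 t := 2 * psi2 (latitude t) / (t + 1) ^+ 3.

Lemma latitude_itv t : 0 <= t -> 0 <= latitude t <= 2.
Proof.
move=> t0; rewrite divr_ge0 ?mulr_ge0 ?addr_ge0//= ler_pdivrMr ?ltr_wpDl//.
lra.
Qed.

Lemma radial_factor_gt0 t : 0 <= t -> 0 < radial_factor t.
Proof.
move=> t0; rewrite mulr_gt0 ?divr_gt0 ?ltr_wpDl//.
exact/psi_gt0/latitude_itv.
Qed.

Let is_derive_succ t : is_derive t 1 (fun u : R => u + 1) 1.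
Proof.
by have := is_derive_add (is_derive_id t 1) (is_derive_cst (1 : R) t 1);
  rewrite addr0.
Qed.

Let is_derive_latitude t : 0 <= t -> is_derive t 1 latitude (2 / (t + 1) ^+ 2).
Proof.
move=> t0; have t1 : t + 1 != 0 by rewrite gt_eqF ?ltr_wpDl.
have d1 := is_derive_succ t.
have d2 := is_derive_mul (is_derive_scale 2 (is_derive_id t 1))
  (@is_derive_inv _ _ (fun u : R => u + 1) t 1 _ t1 d1).
by apply: is_derive_eq d2 _; rewrite /=; field.
Qed.

Let dh t : 0 <= t -> is_derive t 1 radial_factor (h1 t).
Proof.
move=> t0; have t1 : t + 1 != 0 by rewrite gt_eqF ?ltr_wpDl.
have d1 := is_derive_succ t.
have d2 := is_derive_comp (is_derive_latitude t0) (dpsi _).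
have d3 := is_derive_mul (is_derive_mul d1 (is_derive_cst (2^-1 : R) t 1)) d2.
by apply: is_derive_eq d3 _; rewrite /h1 /=; field.
Qed.

Let dh1 t : 0 <= t -> is_derive t 1 h1 (h2 t).
Proof.
move=> t0; have t1 : t + 1 != 0 by rewrite gt_eqF ?ltr_wpDl.
have d1 := is_derive_succ t.
have d2 := is_derive_comp (is_derive_latitude t0) (dpsi _).
have d3 := is_derive_comp (is_derive_latitude t0) (dpsi1 _).
have d4 := is_derive_add (is_derive_mul d2 (is_derive_cst (2^-1 : R) t 1))
  (is_derive_mul d3 (@is_derive_inv _ _ (fun u : R => u + 1) t 1 _ t1 d1)).
by apply: is_derive_eq d4 _; rewrite /h2 /=; field.
Qed.

Let h_neq0 t : 0 <= t -> radial_factor t != 0.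
Proof. by move=> t0; rewrite gt_eqF ?radial_factor_gt0. Qed.

Let chartE : chart_metric (conformal_metric psi) false =
  (fun x : 'rV[R]_n => ((radial_factor (dot x x))^-1 ^+ 2)%:M).
Proof.
apply/funext => x; rewrite chart_conformal_metric.
rewrite /conformal_factor /radial_factor; do 6 f_equal.
have := dotp1_gt0 x; rewrite /height /latitude expr0 mul1r.
by move: (dot x x) => t t0; field; lra.
Qed.

Lemma scalar_curvature_profile x : let t := dot x x in
  scalar_curvature (conformal_metric psi) (stereo_inv false x) =
  4 * (n%:R - 1) * (n%:R * h1 t * (radial_factor t - t * h1 t)
    + 2 * t * radial_factor t * h2 t).
Proof.
by rewrite /scalar_curvature at_point_stereo chartE
  (scalar_curv_radial h_neq0 dh dh1).
Qed.

Lemma sqnorm_ricci0_profile x : (0 < n)%N -> let t := dot x x in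
  sqnorm_ricci0 (conformal_metric psi) (stereo_inv false x) =
  16 * (n%:R - 2) ^+ 2 * (1 - n%:R^-1) * (t * radial_factor t * h2 t) ^+ 2.
Proof.
move=> n0 t; rewrite /sqnorm_ricci0 at_point_stereo chartE.
by rewrite (sqnorm_ricci0_radial h_neq0 dh dh1 _ n0).
Qed.

Lemma volume_density_profile x :
  Num.sqrt (\det (chart_metric (conformal_metric psi) false x)) =
  (radial_factor (dot x x))^-1 ^+ n.
Proof.
rewrite chartE det_scalar exprAC sqrtr_sqr ger0_norm// exprn_ge0// invr_ge0.
exact/ltW/radial_factor_gt0/dot_ge0.
Qed.

Lemma sphere_integral_profile f :
  sphere_integral (conformal_metric psi) f =
  (\int[lebesgueN R n]_t
    let x := \row_i (tnth t i : R) in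
    (f (stereo_inv false x) * (radial_factor (dot x x))^-1 ^+ n)%:E)%E.
Proof.
by apply: eq_integral => t _ /=; rewrite volume_density_profile.
Qed.

End profile_curvature.

(** * A smooth cut-off *)

Section smooth_step.
Context {R : realType}.
Implicit Types v : R.

Definition step v : R := flat 0 v / (flat 0 v + flat 0 (1 - v)).

Let denom_gt0 v : 0 < flat 0 v + flat 0 (1 - v).
Proof.
have [v0|v0] := ltP 0 v; first by rewrite ltr_pwDl ?flat0_gt0 ?flat_ge0.
by rewrite ltr_wpDl ?flat_ge0 ?flat0_gt0//; lra.
Qed.

Lemma tame_step : tame step.
Proof.
apply: tame_mul; first exact/tame_flat/tame_id.
apply: tame_inv => [|v]; last by rewrite gt_eqF.
apply: tame_add; apply: tame_flat; first exact: tame_id.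
by apply: tame_sub; [exact: tame_cst | exact: tame_id].
Qed.

Lemma step_le0 v : v <= 0 -> step v = 0.
Proof. by move=> v0; rewrite /step flat_le0// mul0r. Qed.

Lemma step_ge1 v : 1 <= v -> step v = 1.
Proof.
move=> v1; rewrite /step [flat 0 (1 - v)]flat_le0 ?subr_le0// addr0.
by rewrite divff// gt_eqF// flat0_gt0//; lra.
Qed.

Lemma step_ge0 v : 0 <= step v.
Proof. by rewrite divr_ge0 ?flat_ge0 ?(ltW (denom_gt0 v)). Qed.

Lemma step_le1 v : step v <= 1.
Proof. by rewrite ler_pdivrMr ?denom_gt0// mul1r lerDl flat_ge0. Qed.

Let is_derive_near_cst (f f' : R -> R) c v : is_derive v 1 f (f' v) ->
  (\near v, f v = c) -> f' v = 0.
Proof.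
move=> df fc; have : is_derive v 1 f 0.
  apply: (@near_eq_is_derive _ _ _ (cst c) f v 1) => //.
  by near=> u; apply/esym; near: u.
by move=> [_ d0]; rewrite -d0 derive_val.
Unshelve. all: by end_near. Qed.

Let bounded01 (f : R -> R) : continuous f ->
  (forall v, (v < 0) || (1 < v) -> f v = 0) -> exists M : R, forall v, `|f v| <= M.
Proof.
move=> fc f0.
have cn : {within `[0, 1], continuous (fun v => `|f v|)}.
  apply: continuous_subspaceT => v.
  by apply: continuous_comp; [exact: fc | exact: norm_continuous].
have [c _ cM] := EVT_max ler01 cn.
exists `|f c| => v; have [out|] := boolP ((v < 0) || (1 < v)).
  by rewrite f0// normr0.
by rewrite negb_or -!leNgt => v01; apply: cM; rewrite in_itv.
Qed.

(** Outside [0, 1] the derivatives vanish because the step is locally constant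
    there; on [0, 1] they are continuous, hence bounded. *)
Lemma step_derivatives : exists s1 s2 : R -> R, exists M : R,
  [/\ forall v, is_derive v 1 step (s1 v),
      forall v, is_derive v 1 s1 (s2 v),
      forall v, (v < 0) || (1 < v) -> s1 v = 0 /\ s2 v = 0,
      forall v, `|s1 v| <= M
    & forall v, `|s2 v| <= M].
Proof.
have [s1 ts1 ds] := tame_is_derive (1 : R) tame_step.
have [s2 ts2 ds1] := tame_is_derive (1 : R) ts1.
have s10 v : (v < 0) || (1 < v) -> s1 v = 0.
  move=> /orP[v0|v1].
    apply: (is_derive_near_cst (c := 0) (ds v)).
    by near=> u; rewrite step_le0// ltW//; near: u; exact: lt_nbhsl.
  apply: (is_derive_near_cst (c := 1) (ds v)).
  by near=> u; rewrite step_ge1// ltW//; near: u; exact: lt_nbhsr.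
have s20 v : (v < 0) || (1 < v) -> s2 v = 0.
  move=> out; apply: (is_derive_near_cst (c := 0) (ds1 v)).
  case/orP: out => out; near=> u; apply: s10; apply/orP.
    by left; near: u; exact: lt_nbhsl.
  by right; near: u; exact: lt_nbhsr.
have [M1 hM1] := bounded01 (tame_continuous ts1) s10.
have [M2 hM2] := bounded01 (tame_continuous ts2) s20.
exists s1, s2, (Num.max M1 M2); split=> // v.
- by move=> out; rewrite s10 ?s20.
- by rewrite le_max hM1.
- by rewrite le_max hM2 orbT.
Unshelve. all: by end_near. Qed.

End smooth_step.

(** * Two round spheres joined by a neck *)

Section two_spheres.
Context {R : realType}.
Variables (s1 s2 : R -> R) (M : R).
Hypothesis dstep : forall v : R, is_derive v 1 step (s1 v).
Hypothesis ds1 : forall v : R, is_derive v 1 s1 (s2 v).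
Hypothesis step_flat : forall v, (v < 0) || (1 < v) -> s1 v = 0 /\ s2 v = 0.
Hypothesis s1M : forall v, `|s1 v| <= M.
Hypothesis s2M : forall v, `|s2 v| <= M.
Variable e : R.
Hypothesis e_gt0 : 0 < e.
Hypothesis e_le : e <= 4^-1.
Implicit Type y : R.

(** The affine function [1 + excess y = 2 e + y (1 / e - e)] corresponds to the
    radial factor [e + t / e], a round metric of sectional curvature
    [4 * e * (1 / e) = 4]; the constant [1] corresponds to [(1 + t) / 2], of
    sectional curvature [1]. *)
Definition excess y : R := 2 * e - 1 + y * (e^-1 - e).

Definition two_spheres y : R := 1 + excess y * step (2 - y / e).

Definition two_spheres1 y : R :=
  (e^-1 - e) * step (2 - y / e) - excess y * (s1 (2 - y / e) / e).

Definition two_spheres2 y : R :=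
  excess y * (s2 (2 - y / e) / e ^+ 2) - 2 * (e^-1 - e) * (s1 (2 - y / e) / e).

Let e_neq0 : e != 0. Proof. by rewrite gt_eqF. Qed.

Let slope_ge0 : 0 <= e^-1 - e.
Proof.
have : e * e^-1 = 1 by rewrite divff.
have : 0 < e^-1 by rewrite invr_gt0.
move: e_gt0 e_le; move: (e^-1) => i; nra.
Qed.

Lemma tame_two_spheres : tame two_spheres.
Proof.
have tl (c : R) : tame (fun y : R => y * c).
  by apply: tame_mul; [exact: tame_id | exact: tame_cst].
apply: tame_add; first exact: tame_cst.
apply: tame_mul; first by apply: tame_add; [exact: tame_cst | exact: tl].
apply: tame_comp; first exact: tame_step.
by apply: tame_sub; [exact: tame_cst | exact: tl].
Qed.

Let is_derive_arg y : is_derive y 1 (fun u : R => 2 - u / e) (- e^-1).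
Proof.
have := is_derive_add (is_derive_cst (2 : R) y 1)
  (is_derive_opp (is_derive_scale e^-1 (is_derive_id y 1))).
rewrite add0r mulr1; congr is_derive.
by apply/funext => u; rewrite mulrC.
Qed.

Let is_derive_excess y : is_derive y 1 excess (e^-1 - e).
Proof.
have := is_derive_add (is_derive_cst (2 * e - 1 : R) y 1)
  (is_derive_scale (e^-1 - e) (is_derive_id y 1)).
rewrite add0r mulr1; congr is_derive.
by apply/funext => u; rewrite /excess [u * _]mulrC.
Qed.

Lemma is_derive_two_spheres y : is_derive y 1 two_spheres (two_spheres1 y).
Proof.
have d := is_derive_add (is_derive_cst (1 : R) y 1)
  (is_derive_mul (is_derive_excess y)
    (is_derive_comp (is_derive_arg y) (dstep _))).
by apply: is_derive_eq d _; rewrite /two_spheres1; ring.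
Qed.

Lemma is_derive_two_spheres1 y : is_derive y 1 two_spheres1 (two_spheres2 y).
Proof.
have d1 := is_derive_comp (is_derive_arg y) (dstep _).
have d2 := is_derive_comp (is_derive_arg y) (ds1 _).
have d := is_derive_add (is_derive_scale (e^-1 - e) d1)
  (is_derive_opp (is_derive_mul (is_derive_excess y)
    (is_derive_mul d2 (is_derive_cst (e^-1 : R) y 1)))).
by apply: is_derive_eq d _; rewrite /two_spheres2 /=; field.
Qed.

Lemma two_spheres_inner y : y < e ->
  [/\ two_spheres y = 2 * e + y * (e^-1 - e),
      two_spheres1 y = e^-1 - e & two_spheres2 y = 0].
Proof.
move=> ye; have v1 : 1 < 2 - y / e.
  have : y / e < 1 by rewrite ltr_pdivrMr// mul1r.
  by move: (y / e) => w; lra.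
have [s10 s20] : s1 (2 - y / e) = 0 /\ s2 (2 - y / e) = 0.
  by apply: step_flat; rewrite v1 orbT.
rewrite /two_spheres /two_spheres1 /two_spheres2 step_ge1 ?ltW// s10 s20 /excess.
by split; ring.
Qed.

Lemma two_spheres_outer y : 2 * e < y ->
  [/\ two_spheres y = 1, two_spheres1 y = 0 & two_spheres2 y = 0].
Proof.
move=> ye; have v0 : 2 - y / e < 0.
  by rewrite subr_lt0 ltr_pdivlMr.
have [s10 s20] : s1 (2 - y / e) = 0 /\ s2 (2 - y / e) = 0.
  by apply: step_flat; rewrite v0.
rewrite /two_spheres /two_spheres1 /two_spheres2 step_le0 ?ltW// s10 s20.
by split; ring.
Qed.

Lemma two_spheres_gt0 y : 0 <= y <= 2 -> 0 < two_spheres y.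
Proof.
move=> /andP[y0 _]; rewrite /two_spheres /excess.
have ys : 0 <= y * (e^-1 - e) by rewrite mulr_ge0.
have := step_ge0 (2 - y / e); have := step_le1 (2 - y / e).
move: e_gt0 e_le; move: (step _) (y * _) ys => s z z0; nra.
Qed.

Let excess_itv y : e <= y <= 2 * e -> 0 <= excess y <= 2.
Proof.
move=> /andP[ey y2e]; rewrite /excess mulrBr.
have /andP[] : 1 <= y / e <= 2 by rewrite ler_pdivlMr// ler_pdivrMr// mul1r ey.
have : y * e <= e by move: e_gt0 e_le; nra.
have : 0 <= y * e by move: e_gt0; nra.
have : y * e <= 2 * e * e by rewrite ler_pM2r.
move: e_gt0 e_le; move: (y / e) => w; nra.
Qed.

Lemma two_spheres_ge1 y : e <= y <= 2 * e -> 1 <= two_spheres y.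
Proof.
move=> /excess_itv/andP[e0 _]; rewrite lerDl mulr_ge0//; exact: step_ge0.
Qed.

(** The profile varies on the scale [e]: its derivatives of order [k] are of
    size [e ^ -k], with constants that do not depend on [e]. *)
Lemma two_spheres2_le y : e <= y <= 2 * e ->
  `|two_spheres2 y| <= 4 * M / e ^+ 2.
Proof.
move=> /excess_itv/andP[e0 e2].
have e2_ge0 : 0 <= e ^- 2 by rewrite invr_ge0 sqr_ge0.
rewrite (le_trans (ler_normB _ _))//.
have -> : 4 * M / e ^+ 2 = 2 * (M / e ^+ 2) + 2 * e^-1 * (M / e) by field.
apply: lerD.
  rewrite normrM (ger0_norm e0) ler_pM// normrM (ger0_norm e2_ge0).
  by rewrite ler_wpM2r.
have i_gt0 : 0 < e^-1 by rewrite invr_gt0.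
rewrite normrM ler_pM//.
  rewrite ger0_norm ?mulr_ge0// ler_wpM2l// gerBl; exact: ltW.
by rewrite normrM (gtr0_norm i_gt0) ler_wpM2r// ltW.
Qed.

Section curvature_bounds.
Variable n : nat.
Hypothesis n_gt1 : (1 < n)%N.
Implicit Types (x : 'rV[R]_n) (t : R).

Let psi := two_spheres.
Let h := radial_factor psi.
Let g := @conformal_metric R n psi.

Let nR1 : 1 < n%:R :> R. Proof. by rewrite ltr1n. Qed.

Let nR0 : 0 < n%:R :> R. Proof. exact: lt_trans nR1. Qed.

Let h_gt0 t : 0 <= t -> 0 < h t.
Proof. by move=> t0; apply: radial_factor_gt0 => //; exact: two_spheres_gt0. Qed.

Let latitude_lt t c : 0 <= t -> 2 * t < c -> latitude t < c.
Proof.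
move=> t0 tc; rewrite ltr_pdivrMr ?ltr_wpDl//; nra.
Qed.

(** The ball [t <= e ^ 2] carries a fixed fraction of the small sphere, whose
    radial factor is [e + t / e]. *)
Lemma inner_curvature x : dot x x <= e ^+ 2 ->
  scalar_curvature g (stereo_inv false x) = 4 * (n%:R * (n%:R - 1)) /\
  h (dot x x) <= 2 * e.
Proof.
have := dot_ge0 x; rewrite /g (scalar_curvature_profile two_spheres_gt0
  is_derive_two_spheres is_derive_two_spheres1) /h /radial_factor /psi.
move: (dot x x) => t t0 te.
have [|-> -> ->] := @two_spheres_inner (latitude t).
  by apply: latitude_lt => //; move: e_gt0 e_le; nra.
have t1 : t + 1 != 0 by rewrite gt_eqF ?ltr_wpDl.
split; first by rewrite /latitude; field; rewrite t1 e_neq0.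
have -> : (t + 1) / 2 * (2 * e + latitude t * (e^-1 - e)) = e + t / e.
  by rewrite /latitude; field; rewrite t1 e_neq0.
have : t / e <= e by rewrite ler_pdivrMr// -expr2.
by move: (t / e) => w; lra.
Qed.

Lemma outer_curvature x : 1 <= dot x x ->
  scalar_curvature g (stereo_inv false x) = n%:R * (n%:R - 1) /\
  h (dot x x) <= dot x x.
Proof.
rewrite /g (scalar_curvature_profile two_spheres_gt0
  is_derive_two_spheres is_derive_two_spheres1) /h /radial_factor /psi.
move: (dot x x) => t t1.
have [|-> -> ->] := @two_spheres_outer (latitude t).
  rewrite ltr_pdivlMr; last lra.
  by move: e_gt0 e_le; nra.
have t10 : t + 1 != 0 by rewrite gt_eqF; lra.
split; first by field.
lra.
Qed.

(** The weight [h ^ (2 - n)] is harmless since [h >= 1 / 2] on the neck, and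
    there [t] is of order [e] while the second derivative of the profile is of
    order [e ^ -2]. *)
Lemma neck_ricci0 x :
  sqnorm_ricci0 g (stereo_inv false x) * (h (dot x x))^-1 ^+ n
    <= 16 * (n%:R - 2) ^+ 2 * (16 * M) ^+ 2 * 2 ^+ n / e ^+ 2.
Proof.
have M0 : 0 <= M := le_trans (normr_ge0 _) (s1M 0).
have e2_ge0 : 0 <= e ^- 2 by rewrite invr_ge0 sqr_ge0.
rewrite /g (sqnorm_ricci0_profile two_spheres_gt0
  is_derive_two_spheres is_derive_two_spheres1) ?(ltnW n_gt1)//.
have := dot_ge0 x; move: (dot x x) => t t0.
have t1 : 0 < t + 1 by rewrite ltr_wpDl.
have ht := h_gt0 t0.
rewrite -/psi -/h.
have [out|] := boolP ((latitude t < e) || (2 * e < latitude t)).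
  have -> : two_spheres2 (latitude t) = 0.
    by case/orP: out => [/two_spheres_inner[]|/two_spheres_outer[]].
  rewrite mulr0 mul0r mulr0 expr0n mulr0 mul0r.
  apply: mulr_ge0 => //; apply: mulr_ge0; last exact: exprn_ge0.
  apply: mulr_ge0; last exact: sqr_ge0.
  by apply: mulr_ge0; last exact: sqr_ge0.
rewrite negb_or -!leNgt => /[dup] lat /andP[_ lat2].
have te : t <= 2 * e.
  by move: lat2; rewrite ler_pdivrMr//; move: e_gt0 e_le; nra.
have h2 : 2^-1 <= h t.
  rewrite /h /radial_factor; have := two_spheres_ge1 lat.
  by rewrite -/psi; move: (psi _) => p; nra.
have q2 : (h t)^-1 ^+ (n - 2) <= 2 ^+ n.
  apply: (@le_trans _ _ (2 ^+ (n - 2))); last by rewrite ler_weXn2l ?ler1n ?leq_subr.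
  rewrite lerXn2r ?nnegrE ?invr_ge0 ?(ltW ht)//.
  by rewrite -[leRHS]invrK lef_pV2 ?posrE ?invr_gt0.
have q0 : 0 <= (h t)^-1 ^+ (n - 2) by rewrite exprn_ge0// invr_ge0 ltW.
have A2 : (t * (2 * two_spheres2 (latitude t) / (t + 1) ^+ 3)) ^+ 2 <=
    (16 * M / e) ^+ 2.
  rewrite -[leLHS]real_normK ?num_real// lerXn2r ?nnegrE ?divr_ge0 ?mulr_ge0 ?(ltW e_gt0)//.
  have -> : 16 * M / e = 2 * e * (2 * (4 * M / e ^+ 2) * 1) by field.
  rewrite !normrM (ger0_norm t0) (ger0_norm (ler0n R 2)).
  rewrite ler_pM ?mulr_ge0// ler_pM ?mulr_ge0// ?ler_wpM2l//.
    exact: two_spheres2_le.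
  rewrite ger0_norm ?invr_ge0 ?exprn_ge0 ?(ltW t1)//.
  by rewrite invf_le1 ?exprn_gt0// exprn_ege1// lerDr.
have -> : (t * h t * (2 * two_spheres2 (latitude t) / (t + 1) ^+ 3)) ^+ 2 =
    h t ^+ 2 * (t * (2 * two_spheres2 (latitude t) / (t + 1) ^+ 3)) ^+ 2 by ring.
have -> : (h t)^-1 ^+ n = (h t)^-1 ^+ 2 * (h t)^-1 ^+ (n - 2).
  by rewrite -exprD subnKC.
have ni : 0 <= (1 : R) - n%:R^-1 <= 1.
  by rewrite subr_ge0 invf_le1 ?nR0// (ltW nR1) gerBl invr_ge0 (ltW nR0).
move: ((t * (2 * _ / _)) ^+ 2) (sqr_ge0 (t * (2 * two_spheres2 (latitude t) /
  (t + 1) ^+ 3))) A2 => A A0 A2.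
move: (_ ^+ (n - 2)) q0 q2 => q q0 q2.
have -> : 16 * (n%:R - 2) ^+ 2 * (1 - n%:R^-1) * (h t ^+ 2 * A) *
    ((h t)^-1 ^+ 2 * q) = 16 * (n%:R - 2) ^+ 2 * ((1 - n%:R^-1) * (A * q)).
  by field; rewrite gt_eqF//= gt_eqF.
have -> : 16 * (n%:R - 2) ^+ 2 * (16 * M) ^+ 2 * 2 ^+ n / e ^+ 2 =
    16 * (n%:R - 2) ^+ 2 * (1 * ((16 * M / e) ^+ 2 * 2 ^+ n)) by field.
have /andP[ni0 ni1] := ni.
apply: ler_wpM2l; first by apply: mulr_ge0; last exact: sqr_ge0.
by apply: ler_pM => //; [exact: mulr_ge0 | exact: ler_pM].
Qed.

Lemma neck_support x : 4 * e < dot x x ->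
  sqnorm_ricci0 g (stereo_inv false x) = 0.
Proof.
rewrite /g (sqnorm_ricci0_profile two_spheres_gt0
  is_derive_two_spheres is_derive_two_spheres1) ?(ltnW n_gt1)//.
move: (dot x x) => t te.
have [|_ _ ->] := @two_spheres_outer (latitude t).
  by rewrite ltr_pdivlMr; move: e_gt0 e_le; nra.
by rewrite mulr0 mul0r mulr0 expr0n mulr0.
Qed.

Lemma neck_ricci0_ge0 x : 0 <= sqnorm_ricci0 g (stereo_inv false x).
Proof.
rewrite /g (sqnorm_ricci0_profile two_spheres_gt0
  is_derive_two_spheres is_derive_two_spheres1) ?(ltnW n_gt1)//.
apply: mulr_ge0; last exact: sqr_ge0.
apply: mulr_ge0; first by apply: mulr_ge0; last exact: sqr_ge0.
by rewrite subr_ge0 invf_le1 ?nR0// ltW.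
Qed.

Let density_ge x (u : R) : h (dot x x) <= u -> u^-1 ^+ n <= (h (dot x x))^-1 ^+ n.
Proof.
have hx := h_gt0 (dot_ge0 x); move=> hu.
have u0 : 0 < u := lt_le_trans hx hu.
by rewrite lerXn2r ?nnegrE ?invr_ge0 ?(ltW hx) ?(ltW u0)// lef_pV2.
Qed.

Let density_ge0 x : 0 <= (h (dot x x))^-1 ^+ n.
Proof. by rewrite exprn_ge0// invr_ge0; exact/ltW/h_gt0/dot_ge0. Qed.

Lemma integral_ricci0_ge0 : (0 <= sphere_integral g (sqnorm_ricci0 g))%E.
Proof.
rewrite /g (sphere_integral_profile two_spheres_gt0).
apply: integral_ge0 => t _; rewrite lee_fin; apply: mulr_ge0; last exact: density_ge0.
exact: neck_ricci0_ge0.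
Qed.

(** The neck lies inside the cube of half-side [r]. *)
Lemma integral_ricci0_le (r : R) : 0 <= r -> 4 * e <= r ^+ 2 ->
  (sphere_integral g (sqnorm_ricci0 g) <=
   (16 * (n%:R - 2) ^+ 2 * (16 * M) ^+ 2 * 2 ^+ n / e ^+ 2 * (2 * r) ^+ n)%:E)%E.
Proof.
move=> r0 er; have M0 : 0 <= M := le_trans (normr_ge0 _) (s1M 0).
rewrite /g (sphere_integral_profile two_spheres_gt0).
have -> : 2 * r = r - - r by ring.
apply: integral_le_cube => [||t|t|t ntc] /=.
- lra.
- rewrite mulr_ge0 ?invr_ge0 ?sqr_ge0//; apply: mulr_ge0; last exact: exprn_ge0.
  apply: mulr_ge0; last exact: sqr_ge0.
  by apply: mulr_ge0; last exact: sqr_ge0.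
- by apply: mulr_ge0; [exact: neck_ricci0_ge0 | exact: density_ge0].
- exact: neck_ricci0.
rewrite neck_support ?mul0r// ltNge; apply/negP => te; apply: ntc => i.
rewrite -ler_norml -(@ler_pXn2r _ 2)// ?nnegrE// real_normK ?num_real//.
apply: (le_trans _ er); apply: (le_trans _ te).
rewrite /dot (bigD1 i)//= mxE -expr2 lerDl sumr_ge0// => j _.
by rewrite -expr2 sqr_ge0.
Qed.

(** The scalar curvature is [4 N] on the cube of side [e / n] with a corner at
    the origin, where [h <= 2 e], and [N] on the cube [1, 2] ^ n, where
    [h <= 4 n]. One of these values is at distance at least [1] from [c]; in
    the first case [e] cancels between the density [(2 e) ^ -n] and the volume
    [(e / n) ^ n]. *)
Lemma integral_scalar_deviation_ge (c : R) : (((4 * n%:R)^-1 ^+ n)%:E <=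
  sphere_integral g (fun p => ((scalar_curvature g p - c) ^+ 2)%R))%E.
Proof.
have n0 : (0 < n)%N by exact: ltnW.
have n2 : 2 <= n%:R :> R by rewrite ler_nat.
have n4 : 0 < 4 * n%:R :> R by rewrite mulr_gt0.
have nn0 : n%:R != 0 :> R by rewrite gt_eqF.
rewrite /g (sphere_integral_profile two_spheres_gt0) -/g.
have f0 (t : n.-tuple (measurableTypeR R)) :
    let x := \row_i (tnth t i : R) in
    0 <= (scalar_curvature g (stereo_inv false x) - c) ^+ 2
      * (h (dot x x))^-1 ^+ n.
  by move=> x; apply: mulr_ge0; [exact: sqr_ge0 | exact: density_ge0].
have row_cube a b (t : n.-tuple (measurableTypeR R)) :
    cube n a b t -> forall i, a <= (\row_i (tnth t i : R)) 0 i <= b.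
  by move=> tab i; rewrite mxE.
have big x (u : R) : h (dot x x) <= u ->
    1 <= (scalar_curvature g (stereo_inv false x) - c) ^+ 2 ->
    u^-1 ^+ n <= (scalar_curvature g (stereo_inv false x) - c) ^+ 2
      * (h (dot x x))^-1 ^+ n.
  move=> hu Rc; have u0 : 0 <= u := le_trans (ltW (h_gt0 (dot_ge0 x))) hu.
  rewrite -[leLHS]mul1r ler_pM//; last exact: density_ge.
  by rewrite exprn_ge0// invr_ge0.
set N : R := n%:R * (n%:R - 1).
have N2 : 2 <= N by rewrite /N; nra.
have [cN|cN] := leP c (2 * N).
- have ab : 0 <= e / n%:R by rewrite divr_ge0// ltW.
  apply: le_trans (integral_ge_cube (a := 0) (b := e / n%:R)
    (k := (2 * e)^-1 ^+ n) ab _ f0 _).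
  + have e2 : 0 <= (2 * e)^-1 by rewrite invr_ge0 mulr_ge0// ltW.
    rewrite lee_fin subr0 -exprMn lerXn2r ?nnegrE ?invr_ge0 ?(ltW n4)//.
      exact: mulr_ge0.
    have -> : (2 * e)^-1 * (e / n%:R) = (2 * n%:R)^-1.
      by field; rewrite nn0 e_neq0.
    by rewrite lef_pV2 ?posrE//; lra.
  + by rewrite exprn_ge0// invr_ge0 mulr_ge0// ltW.
  + move=> t /row_cube; set x := \row_i _ => tc /=.
    have xe : dot x x <= e ^+ 2.
      have le1 i : x 0 i * x 0 i <= (e / n%:R) ^+ 2.
        by have /andP[x0 xe] := tc i; rewrite -expr2 lerXn2r ?nnegrE.
      apply: (@le_trans _ _ (\sum_(i < n) (e / n%:R) ^+ 2)).
        by apply: ler_sum => i _; exact: le1.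
      rewrite sumr_const card_ord -[leLHS]mulr_natl.
      have -> : n%:R * (e / n%:R) ^+ 2 = e ^+ 2 / n%:R by field.
      by rewrite ler_pdivrMr; nra.
    have [Rx hx] := inner_curvature xe.
    by apply: big => //; rewrite Rx -/N; nra.
- have n40 : 0 <= (4 * n%:R)^-1 ^+ n :> R by rewrite exprn_ge0// invr_ge0 ltW.
  apply: le_trans (integral_ge_cube (a := 1) (b := 2) _ n40 f0 _).
  + have -> : 2 - 1 = 1 :> R by ring.
    by rewrite expr1n mulr1.
  + lra.
  + move=> t /row_cube; set x := \row_i _ => tc /=.
    have [x1 x4] : 1 <= dot x x /\ dot x x <= 4 * n%:R.
      split.
        rewrite /dot (bigD1 (Ordinal n0))//=.
        have /andP[xi _] := tc (Ordinal n0).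
        have : 0 <= \sum_(i < n | i != Ordinal n0) x 0 i * x 0 i.
          by apply: sumr_ge0 => i _; rewrite -expr2 sqr_ge0.
        by nra.
      apply: (@le_trans _ _ (\sum_(i < n) 4)).
        by apply: ler_sum => i _; have /andP[] := tc i; nra.
      by rewrite sumr_const card_ord -[leLHS]mulr_natr.
    have [Rx hx] := outer_curvature x1.
    by apply: big; [exact: le_trans x4 | rewrite Rx -/N; nra].
Qed.

End curvature_bounds.
End two_spheres.

(** * Failure of the inequality *)

Theorem proposition4p1 (R : realType) (C : R) (n : nat) (hn : (5 <= n)%N) :
  exists g : 'rV[R]_(1 + n) -> 'rV[R]_(1 + n) -> 'rV[R]_(1 + n) -> R,
    riemannian_metric g /\
    ~ (sphere_integral g
         (fun p => ((scalar_curvature g p - average_scalar_curvature g) ^+ 2)%R)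
       <= C%:E * sphere_integral g (sqnorm_ricci0 g))%E.
Proof.
have n1 : (1 < n)%N by apply: leq_trans hn.
have nR : 5 <= n%:R :> R by rewrite ler_nat.
have [s1 [s2 [M [dstep ds1 step_flat s1M s2M]]]] := @step_derivatives R.
(* The integral on the right is nonnegative, so [C] may be increased to [C']. *)
pose C' := Num.max C 0.
have C'0 : 0 <= C' by rewrite le_max lexx orbT.
pose K : R := 16 * (n%:R - 2) ^+ 2 * (16 * M) ^+ 2 * 2 ^+ n.
have K0 : 0 <= K.
  apply: mulr_ge0; last exact: exprn_ge0.
  apply: mulr_ge0; last exact: sqr_ge0.
  by apply: mulr_ge0; last exact: sqr_ge0.
pose m : R := (4 * n%:R)^-1 ^+ n.
have n4 : 0 < 4 * n%:R :> R by lra.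
have m0 : 0 < m by rewrite exprn_gt0// invr_gt0.
have m1 : m <= 1.
  by rewrite exprn_ile1// ?invr_ge0 ?(ltW n4)// invf_le1//; lra.
(* With [e = del ^ 2], the right-hand side is at most [B * del] and the
   left-hand side at least [m]. *)
pose B := C' * (K * 4 ^+ n).
have B0 : 0 <= B.
  by apply: mulr_ge0 => //; apply: mulr_ge0 => //; exact: exprn_ge0.
pose del := m / (2 * (B + 1)).
have del0 : 0 < del by rewrite divr_gt0// mulr_gt0// ltr_wpDl.
have del_ge0 : 0 <= del := ltW del0.
have del2 : del <= 2^-1.
  by rewrite ler_pdivrMr ?mulr_gt0 ?ltr_wpDl//; nra.
have Bdel : B * del < m.
  by rewrite mulrA ltr_pdivrMr ?mulr_gt0 ?ltr_wpDl//; nra.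
pose e := del ^+ 2.
have e0 : 0 < e by rewrite exprn_gt0.
have e4 : e <= 4^-1 by rewrite /e; nra.
pose g := @conformal_metric R n (two_spheres e).
exists g; split.
  apply: riemannian_conformal_metric; last exact: tame_two_spheres.
  by move=> y /(two_spheres_gt0 e0 e4); exact: lt0r_neq0.
have ricci_small : (sphere_integral g (sqnorm_ricci0 g)
    <= (K * 4 ^+ n * del)%:E)%E.
  apply: (le_trans (integral_ricci0_le dstep ds1 step_flat s1M s2M e0 e4 n1
    (r := 2 * del) _ _)).
  - exact: mulr_ge0.
  - by have -> : 4 * e = (2 * del) ^+ 2 by rewrite /e; ring.
  have -> : 2 * (2 * del) = 4 * del by ring.
  rewrite lee_fin -/K.
  have -> : K / e ^+ 2 * (4 * del) ^+ n = K * 4 ^+ n * (del ^+ n / e ^+ 2).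
    rewrite [(4 * del) ^+ n]exprMn; move: (4 ^+ n) (del ^+ n) => p q.
    by clearbody K e; ring.
  apply: ler_wpM2l; first by apply: mulr_ge0 => //; exact: exprn_ge0.
  (* Dimension at least 5 leaves a positive power of [del]: [n - 4 >= 1]. *)
  have -> : del ^+ n = e ^+ 2 * (del * del ^+ (n - 5)).
    by rewrite -exprS /e -exprM -exprD; congr (_ ^+ _); rewrite -{1}(subnKC hn).
  rewrite mulrC mulKf; last by rewrite expf_neq0// gt_eqF.
  by rewrite ler_piMr// exprn_ile1//; lra.
move=> /(le_trans (integral_scalar_deviation_ge dstep ds1 step_flat e0 e4 n1 _)).
rewrite -/m => contra.
have : (m%:E <= C'%:E * (K * 4 ^+ n * del)%:E)%E.
  apply: le_trans contra _.
  apply: (@le_trans _ _ (C'%:E * sphere_integral g (sqnorm_ricci0 g))%E).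
    rewrite lee_wpmul2r ?lee_fin ?le_max ?lexx//.
    exact: (integral_ricci0_ge0 dstep ds1 e0 e4 n1).
  by rewrite lee_wpmul2l// lee_fin.
by rewrite -EFinM lee_fin [C' * _]mulrA leNgt Bdel.
Qed.
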